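(* Let $X$ be a finite biquandle, let $D$ be a knotoid diagram in $S^2$ or $\mathbb{R}^2$ with an $X$-coloring $f$, and let $D'$ be obtained from $D$ by a single Reidemeister move performed in a disk disjoint from the endpoints, with $f'$ the unique $X$-coloring of $D'$ agreeing with $f$ outside that disk. Then the biquandle longitude weights agree: $BLW(D'_{f'})=BLW(D_f)$ as bijections $X\to X$.
   Context: A biquandle is a set $X$ together with, for each $b\in X$, two bijections $\alpha_b,\beta_b:X\to X$ such that: (i) $\alpha_a(a)=\beta_a(a)$ for all $a$; (ii) $S(a,b)=(\alpha_a(b),\beta_b(a))$ is an invertible map $X\times X\to X\times X$; (iii) $\alpha_{\alpha_a(b)}\alpha_a=\alpha_{\beta_b(a)}\alpha_b$, $\beta_{\alpha_a(b)}\alpha_a=\alpha_{\beta_b(a)}\beta_b$, $\beta_{\beta_a(b)}\beta_a=\beta_{\alpha_b(a)}\beta_b$ for all $a,b$. A knotoid diagram in $\Sigma=S^2$ or $\mathbb{R}^2$ is a generic immersion of $[0,1]$ with finitely many transverse double points (crossings) with over/under information, oriented from the tail (image of $0$) to the head (image of $1$), these being distinct non-crossing points; Reidemeister moves on knotoid diagrams are the usual three moves performed in disks disjoint from the endpoints. A semiarc is a piece of the curve between consecutive crossings, or between an endpoint and a crossing. Crossings carry the usual sign $\pm 1$. An $X$-coloring of a diagram assigns an element of $X$ to each semiarc such that: at a positive crossing, if the incoming under-semiarc is colored $a$ and the outgoing over-semiarc is colored $b$, then the outgoing under-semiarc is colored $\beta_b(a)$ and the incoming over-semiarc is colored $\alpha_a(b)$;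 at a negative crossing, if the outgoing under-semiarc is colored $a$ and the incoming over-semiarc is colored $b$, then the incoming under-semiarc is colored $\beta_b(a)$ and the outgoing over-semiarc is colored $\alpha_a(b)$. For any Reidemeister move, each coloring before the move extends uniquely to a coloring after the move agreeing outside the disk of the move. Biquandle longitude weight: traveling along the colored diagram $D_f$ from tail to head, each crossing is passed twice. To each pass assign the bijection $\beta_L^{jk}:X\to X$, where $j\in\{\pm1\}$ is the sign of the crossing, $k=1$ if the pass goes under and $k=-1$ if it goes over, and $L\in X$ is the color of the semiarc of the other strand at that crossing which lies to the right of the direction of travel. Then $BLW(D_f)$ is the composition of these bijections in the order they are encountered, the first encountered being applied first (i.e. if the passes give $\beta_{L_1}^{e_1},\dots,\beta_{L_m}^{e_m}$ in order, $BLW(D_f)=\beta_{L_m}^{e_m}\circ\cdots\circ\beta_{L_1}^{e_1}$); for a crossingless diagram it is the identity. *)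

(* Defs.v *)
From mathcomp Require Import all_boot fingroup perm.
Set Implicit Arguments. Unset Strict Implicit. Unset Printing Implicit Defensive.


Definition biquandle (X : finType) (al be : X -> {perm X}) : Prop :=
  [/\ forall a, al a a = be a a,
      bijective (fun ab : X * X => (al ab.1 ab.2, be ab.2 ab.1)),
      forall a b x, al (al a b) (al a x) = al (be b a) (al b x),
      forall a b x, be (al a b) (al a x) = al (be b a) (be b x) &
      forall a b x, be (be a b) (be a x) = be (al b a) (be b x)].

(* A knotoid diagram with m crossings is encoded by the sequence of the
   2m passes met when travelling from the tail to the head.
   A pass is (label of the crossing, passes over?, crossing positive?).
   Event i (0 <= i < size w) lies between semiarc i and semiarc i+1;
   semiarc 0 starts at the tail, semiarc (size w) ends at the head.   *)
Definition pass := (nat * bool * bool)%type.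
Definition lab (p : pass) : nat := p.1.1.
Definition over (p : pass) : bool := p.1.2.
Definition pos (p : pass) : bool := p.2.
Definition dpass : pass := (0, false, false).

Definition gauss_valid (w : seq pass) : bool :=
  all (fun p => (count (fun q => lab q == lab p) w == 2) &&
                has (fun q => [&& lab q == lab p, over q != over p & pos q == pos p]) w) w.

Definition n_cross (w : seq pass) : nat := size (undup (map lab w)).

Definition over_ev (w : seq pass) (c : nat) : nat :=
  find (fun p => (lab p == c) && over p) w.
Definition under_ev (w : seq pass) (c : nat) : nat :=
  find (fun p => (lab p == c) && ~~ over p) w.

(* Darts (half-edges): (k, false) = initial end of semiarc k,
                       (k, true)  = terminal end of semiarc k.        *)
Definition dart := (nat * bool)%type.

(* The four darts at the crossing met at event i, in counterclockwise
   order.  Positive crossing: under strand crosses the over strand from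
   its right to its left, so ccw: over-out, under-out, over-in, under-in.
   Negative crossing: over strand crosses the under strand from right to
   left: under-out, over-out, under-in, over-in.                       *)
Definition ccw_darts (w : seq pass) (i : nat) : seq dart :=
  let p := nth dpass w i in
  let o := over_ev w (lab p) in let u := under_ev w (lab p) in
  if pos p then [:: (o.+1, false); (u.+1, false); (o, true); (u, true)]
  else [:: (u.+1, false); (o.+1, false); (u, true); (o, true)].

(* vertex rotation (counterclockwise successor); the two endpoints are
   univalent vertices *)
Definition sigma (w : seq pass) (d : dart) : dart :=
  if d == (0, false) then d else
  if d == (size w, true) then d else
  next (ccw_darts w (if d.2 then d.1 else d.1.-1)) d.

Definition edge_inv (d : dart) : dart := (d.1, ~~ d.2).
Definition phi (w : seq pass) (d : dart) : dart := sigma w (edge_inv d).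

Definition phiF (w : seq pass) (d : 'I_(size w).+1 * bool) : 'I_(size w).+1 * bool :=
  let d' := phi w (val d.1, d.2) in (inord d'.1, d'.2).

Definition n_faces (w : seq pass) : nat :=
  fcard (@phiF w) (predT : pred ('I_(size w).+1 * bool)).

(* Euler characteristic: V - E + F = 2 with V = #crossings + 2 endpoints
   and E = #semiarcs = size w + 1 *)
Definition planar (w : seq pass) : bool :=
  n_cross w + 2 + n_faces w == (size w).+1 + 2.

(* knotoid diagram in S^2 (up to isotopy) *)
Definition knotoid_diagram (w : seq pass) : bool := gauss_valid w && planar w.

Definition bigon_face (w : seq pass) (s1 s2 : nat) : Prop :=
  exists d1 d2 : dart, [/\ d1.1 = s1, d2.1 = s2, phi w d1 = d2 & phi w d2 = d1].

Definition triangle_face (w : seq pass) (s1 s2 s3 : nat) : Prop :=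
  exists d1 d2 d3 : dart,
    [/\ d1.1 = s1, (d2.1 = s2 /\ d3.1 = s3) \/ (d2.1 = s3 /\ d3.1 = s2),
        phi w d1 = d2, phi w d2 = d3 & phi w d3 = d1].

(* Reidemeister moves.  cor k k' holds when semiarc k of the first
   diagram and semiarc k' of the second diagram share a piece outside the
   disk of the move (they are "the same semiarc outside the disk").    *)

(* R1: insertion of a kink (loop) into semiarc size u of ws. *)
Definition R1ins (ws wb : seq pass) (cor : nat -> nat -> bool) : Prop :=
  exists u t (p1 p2 : pass),
    [/\ ws = u ++ t, wb = u ++ [:: p1; p2] ++ t, lab p1 = lab p2 &
        forall k k', cor k k' =
          ((k <= size u) && (k' == k)) || ((size u <= k) && (k' == k + 2))].

(* R2: creation of a bigon between two pieces of strand, lying in semiarcs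
   size u and size u + size v of ws; one strand passes over at both new
   crossings, and the new bigon is a face. *)
Definition R2ins (ws wb : seq pass) (cor : nat -> nat -> bool) : Prop :=
  exists u v t (a1 a2 b1 b2 : pass),
    [/\ ws = u ++ v ++ t, wb = u ++ [:: a1; a2] ++ v ++ [:: b1; b2] ++ t,
        [&& lab a1 != lab a2, perm_eq [:: lab b1; lab b2] [:: lab a1; lab a2]
          & over a1 == over a2],
        bigon_face wb (size u).+1 (size u + size v + 3) &
        forall k k', cor k k' =
          [|| (k <= size u) && (k' == k),
              (size u <= k <= size u + size v) && (k' == k + 2) |
              (size u + size v <= k) && (k' == k + 4)]].

(* R3: three pieces of strand, pairwise crossing once, bounding a
   triangular face, one of them passing over both of its crossings;
   the strand pieces are slid across, reversing the order of the two
   passes on each piece.  Signs and over/under data are unchanged. *)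
Definition R3 (w w' : seq pass) (cor : nat -> nat -> bool) : Prop :=
  exists u1 u2 u3 u4 (x1 x2 y1 y2 z1 z2 : pass) (a b c : nat),
    let sx := (size u1).+1 in
    let sy := size u1 + size u2 + 3 in
    let sz := size u1 + size u2 + size u3 + 5 in
    [/\ w = u1 ++ [:: x1; x2] ++ u2 ++ [:: y1; y2] ++ u3 ++ [:: z1; z2] ++ u4 /\
        w' = u1 ++ [:: x2; x1] ++ u2 ++ [:: y2; y1] ++ u3 ++ [:: z2; z1] ++ u4,
        [&& lab x1 != lab x2, lab y1 != lab y2, lab z1 != lab z2,
            uniq [:: a; b; c] &
            perm_eq (map lab [:: x1; x2; y1; y2; z1; z2]) [:: a; a; b; b; c; c]],
        [|| over x1 && over x2, over y1 && over y2 | over z1 && over z2],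
        triangle_face w sx sy sz &
        forall k k', cor k k' = (k' == k) && (k \notin [:: sx; sy; sz])].

Definition reidemeister_move (w w' : seq pass) (cor : nat -> nat -> bool) : Prop :=
  R1ins w w' cor \/ R1ins w' w (fun k' k => cor k k') \/
  R2ins w w' cor \/ R2ins w' w (fun k' k => cor k k') \/ R3 w w' cor.

(* X-colorings: f k is the color of semiarc k. *)
Definition coloring (X : finType) (al be : X -> {perm X}) (w : seq pass)
    (f : nat -> X) : Prop :=
  forall i, i < size w -> ~~ over (nth dpass w i) ->
    let p := nth dpass w i in
    let u := i in let o := over_ev w (lab p) in
    if pos p then
      (* incoming under a = f u, outgoing over b = f o.+1 *)
      f u.+1 = be (f o.+1) (f u) /\ f o = al (f u) (f o.+1)
    else
      (* outgoing under a = f u.+1, incoming over b = f o *)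
      f u = be (f o) (f u.+1) /\ f o.+1 = al (f u.+1) (f o).

(* the semiarc to the right of the direction of travel at event i:
   the dart preceding the outgoing dart (i+1, false) in ccw order *)
Definition right_semiarc (w : seq pass) (i : nat) : nat :=
  (prev (ccw_darts w i) (i.+1, false)).1.

Definition pass_perm (X : finType) (be : X -> {perm X}) (w : seq pass)
    (f : nat -> X) (i : nat) : {perm X} :=
  let p := nth dpass w i in
  let L := f (right_semiarc w i) in
  (* j = +1 iff pos p, k = +1 iff under; jk = +1 iff pos p = ~~ over p *)
  if pos p == ~~ over p then be L else ((be L)^-1)%g.

(* BLW = beta_m o ... o beta_1 ; in {perm X}, (s * t) x = t (s x). *)
Definition BLW (X : finType) (be : X -> {perm X}) (w : seq pass)
    (f : nat -> X) : {perm X} :=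
  foldr (fun i acc => (pass_perm be w f i * acc)%g) 1%g (iota 0 (size w)).

(* Main.v *)
(** Say that a pass has exponent [+1] when it crosses the other strand from
    its right to its left.  Whatever the over/under data, a pass then
    contributes [be L] or its inverse according to this exponent, [L] being
    the color of the other strand on the right of the traveller.  In R1 and R2
    the two new factors on each strand have opposite exponents and the same
    color, so they cancel.  In R3, consider the path running just to the right
    of one of the three strands: it meets the other two strands on one side of
    their common crossing before the move, and on the other side after it.  The
    last biquandle axiom says that the composite of the [be]'s around a
    crossing is trivial, so the contribution of each strand is unchanged. *)

From mathcomp Require Import all_boot fingroup perm zify.
Require Import Defs.
Set Implicit Arguments. Unset Strict Implicit. Unset Printing Implicit Defensive.

(** * The two passes of a crossing, and the face permutation in terms of exponents *)

Definition partner (w : seq pass) (i : nat) : nat :=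
  let p := nth dpass w i in
  if over p then under_ev w (lab p) else over_ev w (lab p).

(* The exponent of the pass is [+1], i.e. it goes from the right to the left of
   the other strand. *)
Definition r2l (w : seq pass) (i : nat) : bool :=
  let p := nth dpass w i in pos p == ~~ over p.

Lemma count_index_ge (w : seq pass) (P : pred pass) (s : seq nat) :
  uniq s -> {in s, forall i, i < size w /\ P (nth dpass w i)} ->
  size s <= count P w.
Proof.
move=> us sP.
have -> : count P w = size [seq i <- iota 0 (size w) | P (nth dpass w i)].
  by rewrite -{1}(mkseq_nth dpass w) /mkseq count_map size_filter.
apply: uniq_leq_size => // i /sP [ltiw Pi].
by rewrite mem_filter Pi mem_iota.
Qed.

Section Partner.
Variables (w : seq pass).
Hypothesis wv : gauss_valid w.

(** A label occurs exactly twice in a valid word, so three distinct positions cannot share it. *)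
Lemma same_lab_eq i j k : i < size w -> j < size w -> k < size w ->
  lab (nth dpass w j) = lab (nth dpass w i) ->
  lab (nth dpass w k) = lab (nth dpass w i) ->
  j != i -> k != i -> j = k.
Proof.
move=> ltiw ltjw ltkw lj lk ji ki; apply/eqP; apply: contraT => jk.
have /andP[/eqP c2 _] := allP wv _ (mem_nth dpass ltiw).
have: size [:: i; j; k] <= 2.
  rewrite -c2; apply: count_index_ge.
    by rewrite /= !inE negb_or eq_sym ji eq_sym ki jk.
  by move=> l; rewrite !inE => /or3P[] /eqP ->; rewrite ?lj ?lk.
by [].
Qed.

Lemma ev_unique (P : pred pass) i : i < size w -> P (nth dpass w i) ->
  (forall j, j < size w -> P (nth dpass w j) -> j = i) -> find P w = i.
Proof.
move=> ltiw Pi uP.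
have hP : has P w by apply/hasP; exists (nth dpass w i); rewrite ?mem_nth.
by apply: uP; rewrite -?has_find // nth_find.
Qed.

(** Validity provides a position with the same label and the opposite level. Since a label has only
    two positions, the [find] behind [partner] must return this one. *)
Lemma partnerP i : i < size w ->
  [/\ partner w i < size w, partner w i != i,
      lab (nth dpass w (partner w i)) = lab (nth dpass w i),
      over (nth dpass w (partner w i)) = ~~ over (nth dpass w i) &
      pos (nth dpass w (partner w i)) = pos (nth dpass w i)].
Proof.
move=> ltiw.
have /andP[_ /hasP[q /(nthP dpass)[j ltjw <-] /and3P[/eqP lj oj /eqP pj]]] :=
  allP wv _ (mem_nth dpass ltiw).
have ji : j != i by apply: contraNneq oj => ->.
have oj' : over (nth dpass w j) = ~~ over (nth dpass w i).
  by move: oj; case: (over _); case: (over _).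
suff -> : partner w i = j by [].
rewrite /partner; case: ifP oj' => oi /= oj'.
  apply: ev_unique => //=; rewrite ?lj ?eqxx ?oj' // => k ltkw /andP[/eqP lk ok].
  by apply: (same_lab_eq ltiw) => //; apply: contraNneq ok => ->.
apply: ev_unique => //=; rewrite ?lj ?eqxx ?oj' // => k ltkw /andP[/eqP lk ok].
by apply: (same_lab_eq ltiw) => //; apply: contraTneq ok => ->; rewrite oi.
Qed.

Lemma partner_unique i j : i < size w -> j < size w -> j != i ->
  lab (nth dpass w j) = lab (nth dpass w i) -> partner w i = j.
Proof.
move=> ltiw ltjw ji lj; have [? ? ? ? ?] := partnerP ltiw.
exact: (same_lab_eq ltiw).
Qed.

Lemma partnerK i : i < size w -> partner w (partner w i) = i.
Proof.
move=> ltiw; have [? ? ? ? ?] := partnerP ltiw.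
by apply: partner_unique; rewrite // eq_sym.
Qed.

Lemma partner_sym i j : i < size w -> partner w i = j -> partner w j = i.
Proof. by move=> ltiw <-; rewrite partnerK. Qed.

Lemma r2l_partner i : i < size w -> r2l w (partner w i) = ~~ r2l w i.
Proof.
move=> ltiw; have [_ _ _ o p] := partnerP ltiw; rewrite /r2l o p.
by case: (pos _); case: (over _).
Qed.

Lemma evE i : i < size w ->
  let p := nth dpass w i in
  over_ev w (lab p) = (if over p then i else partner w i) /\
  under_ev w (lab p) = (if over p then partner w i else i).
Proof.
move=> ltiw /=; have [ltjw ji lj oj pj] := partnerP ltiw.
have := partnerK ltiw; rewrite {1}/partner lj oj /partner.
by case: (over _).
Qed.

Lemma ccw_dartsE i : i < size w ->
  let j := partner w i in
  ccw_darts w i =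
    if over (nth dpass w i) then
      if pos (nth dpass w i)
      then [:: (i.+1, false); (j.+1, false); (i, true); (j, true)]
      else [:: (j.+1, false); (i.+1, false); (j, true); (i, true)]
    else
      if pos (nth dpass w i)
      then [:: (j.+1, false); (i.+1, false); (j, true); (i, true)]
      else [:: (i.+1, false); (j.+1, false); (i, true); (j, true)].
Proof.
move=> ltiw /=; rewrite /ccw_darts; have [-> ->] := evE ltiw.
by case: (over _); case: (pos _).
Qed.

(** Semiarc [a.+1] joins events [a] and [a.+1]; starting from its dart [d], one arrives at event
    [a + ~~ d]. Rotating counterclockwise there is a right turn for the traveller, so the face lies
    on the right, and the exponent decides whether the turn leads onto the outgoing or the incoming
    semiarc of the other strand. *)
Lemma phiE a (d : bool) : a + ~~ d < size w ->
  let j := partner w (a + ~~ d) in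
  phi w (a.+1, d) = if r2l w (a + ~~ d) == ~~ d then (j.+1, false) else (j, true).
Proof.
move=> lt; have [_ ji _ _ _] := partnerP lt.
have jf : (partner w (a + ~~ d) == a + ~~ d) = false by apply/negbTE.
have fj : (a + ~~ d == partner w (a + ~~ d)) = false by rewrite eq_sym.
move=> j; rewrite -/j in jf fj; rewrite /phi /sigma /edge_inv /r2l -/j.
have -> : ((a.+1, ~~ d) == (0, false)) = false by [].
have -> : ((a.+1, ~~ d) == (size w, true)) = false.
  by rewrite xpair_eqE; case: d @j {ji jf fj} lt => /=; lia.
have -> : (if (a.+1, ~~ d).2 then (a.+1, ~~ d).1 else (a.+1, ~~ d).1.-1) = a + ~~ d.
  by case: d @j {ji jf fj} lt => /=; lia.
rewrite ccw_dartsE // -/j; move: j jf fj {ji lt}.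
case: d => /= j; rewrite ?addn0 ?addn1;
  case: (over _); case: (pos _) => /= jf fj;
  by rewrite !xpair_eqE ?eqSS ?jf ?fj ?eqxx ?andbF.
Qed.

(** Throughout, [b + t] with [t] boolean denotes the pass at the initial ([t = false]) or terminal
    ([t = true]) end of semiarc [b.+1]. Landing on that semiarc after a turn at [b + t] fixes the
    end, hence the exponent. *)
Lemma phi_segment a (d d' : bool) b (t : bool) : a + ~~ d < size w ->
  partner w (a + ~~ d) = b + t -> phi w (a.+1, d) = (b.+1, d') ->
  d' = t /\ (r2l w (a + ~~ d) == ~~ d) = ~~ t.
Proof.
move=> lt pE; rewrite phiE // pE.
by case: t {pE}; case: eqP => _ [] /=; rewrite ?addn0 ?addn1 => //; lia.
Qed.

End Partner.

(** * The contribution of a pass, and the biquandle relation at a crossing *)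

Section Perms.
Variables (X : finType) (al be : X -> {perm X}).
Implicit Types (f : nat -> X) (w : seq pass).
Local Open Scope group_scope.

(** On the right of the traveller lies the outgoing semiarc of the strand crossed at pass [j] if the
    exponent is positive, the incoming one otherwise. *)
Definition crossing_perm f (j : nat) (e : bool) : {perm X} :=
  if e then be (f j.+1) else (be (f j))^-1.

Lemma pass_permE w f i : gauss_valid w -> (i < size w)%N ->
  pass_perm be w f i = crossing_perm f (partner w i) (r2l w i).
Proof.
move=> wv ltiw; have [_ ji _ _ _] := partnerP wv ltiw.
have jf : (partner w i == i) = false by apply/negbTE.
have fj : (i == partner w i) = false by rewrite eq_sym.
rewrite /pass_perm /right_semiarc /crossing_perm /r2l (ccw_dartsE wv) //=.
case: (over _); case: (pos _) => /=;
  by rewrite ?xpair_eqE ?eqSS ?jf ?fj ?eqxx ?andbF.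
Qed.

Lemma BLW_prod w f : BLW be w f = \prod_(0 <= i < size w) pass_perm be w f i.
Proof. by rewrite /BLW unlock /index_iota subn0. Qed.

Hypothesis bq : biquandle al be.

(** This is the last biquandle axiom read as an identity of products, the left factor acting first.
    Pass [i] is either under at a positive crossing or over at a negative one; the coloring rule,
    taken at the under pass, gives the two sides of the axiom. *)
Lemma crossing_flat w f i j : gauss_valid w -> coloring al be w f ->
  (i < size w)%N -> partner w i = j -> r2l w i ->
  be (f i) * be (f j) = be (f j.+1) * be (f i.+1).
Proof.
have [_ _ _ _ be3] := bq.
have be3' a b : be a * be (be a b) = be b * be (al b a).
  by apply/permP => x; rewrite !permM be3.
move=> wv fc ltiw <-; have [ltjw ji lj oj pj] := partnerP wv ltiw.
have [oE _] := evE wv ltiw; rewrite /r2l => /eqP r.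
case oi: (over (nth dpass w i)) in oE oj r.
  have /= := fc _ ltjw; rewrite oj pj r /= lj oE => /(_ isT) [-> ->].
  by rewrite be3'.
have /= := fc _ ltiw; rewrite oi r /= oE => /(_ isT) [-> ->].
by rewrite be3'.
Qed.
End Perms.

(** * Transport of passes between two diagrams *)

Section Transfer.
Variables (w w' : seq pass) (rho : nat -> nat).
Hypotheses (wv : gauss_valid w) (wv' : gauss_valid w') (rhoI : injective rho).
Hypothesis rho_lt : forall i, i < size w -> rho i < size w'.
Hypothesis rho_nth : forall i, nth dpass w' (rho i) = nth dpass w i.

Lemma partner_transfer i : i < size w -> partner w' (rho i) = rho (partner w i).
Proof.
move=> ltiw; have [ltjw ji lj _ _] := partnerP wv ltiw.
by apply: partner_unique => //; rewrite ?rho_lt ?(inj_eq rhoI) ?rho_nth.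
Qed.

Lemma r2l_transfer i : r2l w' (rho i) = r2l w i.
Proof. by rewrite /r2l rho_nth. Qed.

(** A contribution depends only on the exponent, which [rho] preserves, and on the colors of the two
    semiarcs adjacent to the partner. *)
Lemma pass_perm_transfer (X : finType) (be : X -> {perm X}) (f f' : nat -> X) i :
  i < size w -> f' (rho (partner w i)) = f (partner w i) ->
  f' (rho (partner w i)).+1 = f (partner w i).+1 ->
  pass_perm be w' f' (rho i) = pass_perm be w f i.
Proof.
move=> ltiw f0 f1; rewrite !pass_permE ?rho_lt // partner_transfer // r2l_transfer.
by rewrite /crossing_perm f0 f1.
Qed.
End Transfer.

(* Position, after insertion of two passes at position [n], of the pass that was
   at position [i]. *)
Definition skip2 (n i : nat) : nat := if i < n then i else i.+2.

Lemma skip2_inj n : injective (skip2 n).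
Proof. by move=> i j; rewrite /skip2; case: ifP; case: ifP; lia. Qed.

Lemma nth_skip2 (u t : seq pass) a b i :
  nth dpass (u ++ [:: a; b] ++ t) (skip2 (size u) i) = nth dpass (u ++ t) i.
Proof.
rewrite /skip2 [LHS]nth_cat [RHS]nth_cat.
case: (ltnP i (size u)) => [->//|le].
have -> : (i.+2 < size u) = false by lia.
have -> : (i.+2 - size u) = (i - size u).+2 by lia.
by [].
Qed.

Lemma prod_skip2 (gT : finGroupType) (F : nat -> gT) n N : n <= N ->
  (F n * F n.+1 = 1)%g ->
  (\prod_(0 <= i < N.+2) F i = \prod_(0 <= i < N) F (skip2 n i))%g.
Proof.
move=> leN F1.
rewrite (@big_cat_nat _ _ _ n) //=; last by lia.
rewrite [in RHS](@big_cat_nat _ _ _ n) //=; congr (_ * _)%g.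
  by apply: eq_big_nat => i /andP[_ lt]; rewrite /skip2 lt.
rewrite big_ltn; last by lia.
rewrite big_ltn; last by lia.
rewrite mulgA F1 mul1g -(addn2 n) -(addn2 N) big_addn addnK.
apply: eq_big_nat => i /andP[le _]; by rewrite /skip2 ltnNge le addn2.
Qed.

Lemma prod_pair (gT : finGroupType) (F : nat -> gT) a n b : a <= n -> n.+1 < b ->
  (\prod_(a <= i < b) F i =
   \prod_(a <= i < n) F i * (F n * F n.+1 * \prod_(n.+2 <= i < b) F i))%g.
Proof.
move=> le lt; rewrite (@big_cat_nat _ _ _ n) //=; last by lia.
congr (_ * _)%g; rewrite big_ltn; last by lia.
by rewrite big_ltn // mulgA.
Qed.

(** * Invariance under R1 and R2 *)

Section Moves.
Variables (X : finType) (be : X -> {perm X}).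
Implicit Types (f : nat -> X) (w : seq pass).

(** The hypothesis says that both factors read the same color: a pass of exponent [e] whose partner
    is [i] reads the color of semiarc [i + e]. *)
Lemma crossing_perm_cancel f i j (e : bool) : f (i + e) = f (j + ~~ e) ->
  (crossing_perm be f i e * crossing_perm be f j (~~ e) = 1)%g.
Proof.
rewrite /crossing_perm.
by case: e; rewrite /= ?addn0 ?addn1 => ->; rewrite ?mulgV ?mulVg.
Qed.

Lemma BLW_R1ins ws wb cor f f' : gauss_valid ws -> gauss_valid wb ->
  R1ins ws wb cor -> (forall k k', cor k k' -> f' k' = f k) ->
  BLW be wb f' = BLW be ws f.
Proof.
move=> sv bv [u [t [p1 [p2 [ws_def wb_def lp corE]]]]] ff'.
have fL k : k <= size u -> f' k = f k.
  by move=> le; apply: ff'; rewrite corE le eqxx.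
have fR k : size u <= k -> f' k.+2 = f k.
  by move=> le; apply: ff'; rewrite corE le addn2 eqxx orbT.
have szs : size ws = size u + size t by rewrite ws_def size_cat.
have szb : size wb = (size ws).+2 by rewrite szs wb_def !size_cat /=; lia.
have n1 : nth dpass wb (size u) = p1 by rewrite wb_def nth_cat ltnn subnn.
have n2 : nth dpass wb (size u).+1 = p2.
  by rewrite wb_def nth_cat ltnNge leqnSn /= subSnn.
have lt1 : size u < size wb by lia.
have lt2 : (size u).+1 < size wb by lia.
have P1 : partner wb (size u) = (size u).+1.
  by apply: partner_unique => //; rewrite ?n1 ?n2 //; lia.
have P2 := partner_sym bv lt1 P1.
rewrite !BLW_prod szb (@prod_skip2 _ _ (size u)); first last.
- rewrite !pass_permE // P2 -P1 r2l_partner // P1.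
  (* If the first pass of the kink has positive exponent, the two colors read are those just after
     and just before the kink, which come from one semiarc of [ws]; otherwise both passes read the
     loop. *)
  apply: crossing_perm_cancel; case: (r2l _ _); rewrite /= ?addn0 ?addn1 //.
  by rewrite fR // fL.
- by lia.
apply: eq_big_nat => i /andP[_ lti].
apply: (pass_perm_transfer sv bv (@skip2_inj (size u))) => //.
- by move=> k ltk; rewrite szb /skip2; case: ifP; lia.
- by move=> k; rewrite wb_def ws_def nth_skip2.
- by rewrite /skip2; case: ltnP => le; [rewrite fL // ltnW | rewrite fR].
by rewrite /skip2; case: ltnP => le; [rewrite fL | rewrite fR // leqW].
Qed.

(** Each of the two turns along the bigon determines the exponent at one crossing by [phi_segment];
    both are governed by [s], which is false for parallel strands and true for antiparallel ones. *)
Lemma bigon_r2l w n m (s : bool) : gauss_valid w ->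
  n.+1 < size w -> m.+1 < size w -> n.+1 < m ->
  partner w n = m + s -> partner w n.+1 = m + ~~ s ->
  bigon_face w n.+1 m.+1 -> r2l w n.+1 = ~~ r2l w n.
Proof.
move=> wv ltn ltm nm P1 P2 [[_ d1] [[_ d2] [/= -> -> ph1 ph2]]].
have Q1 := partner_sym wv (ltnW ltn) P1.
have Q2 := partner_sym wv ltn P2.
have R1 := r2l_partner wv (ltnW ltn); rewrite P1 in R1.
have R2 := r2l_partner wv ltn; rewrite P2 in R2.
have lt1 : n + ~~ d1 < size w by case: (d1); lia.
have lt2 : m + ~~ d2 < size w by case: (d2); lia.
have E1 t pt := @phi_segment w wv n d1 d2 m t lt1 pt ph1.
have E2 t pt := @phi_segment w wv m d2 d1 n t lt2 pt ph2.
(* [d1] tells on which side of semiarc [n.+1] the bigon lies, hence at which end the first turn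
   occurs. *)
move: E1 E2; case: d1 {lt1 ph1 ph2} => /=; rewrite ?addn0 ?addn1 => E1 E2.
  have [ds e1] := E1 _ P1; subst d2.
  have [_] := E2 true (etrans Q2 (esym (addn1 n))); rewrite R2.
  by move: e1; case: s {P1 P2 Q1 Q2 R1 R2 lt2 E1 E2}; case: (r2l _ _); case: (r2l _ _).
have [ds e1] := E1 _ P2; subst d2.
rewrite negbK in E2.
have [_] := E2 false (etrans Q1 (esym (addn0 n))); rewrite R1.
by move: e1; case: s {P1 P2 Q1 Q2 R1 R2 lt2 E1 E2}; case: (r2l _ _); case: (r2l _ _).
Qed.

Lemma BLW_R2ins ws wb cor f f' : gauss_valid ws -> gauss_valid wb ->
  R2ins ws wb cor -> (forall k k', cor k k' -> f' k' = f k) ->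
  BLW be wb f' = BLW be ws f.
Proof.
move=> sv bv [u [v [t [a1 [a2 [b1 [b2 [ws_def wb_def]]]]]]]].
move=> /and3P[la lb _] big corE ff'.
(* [m] is the position of [b1] in [wb], shifted by the two passes inserted at [n]. *)
set n := size u in big corE; pose m := (n + size v).+2.
have fL k : k <= n -> f' k = f k.
  by move=> le; apply: ff'; rewrite corE le eqxx.
have fM k : n <= k <= n + size v -> f' k.+2 = f k.
  by move=> le; apply: ff'; rewrite corE le addn2 eqxx orbT.
have fR k : n + size v <= k -> f' k.+4 = f k.
  by move=> le; apply: ff'; rewrite corE le addn4 eqxx !orbT.
have szs : size ws = n + size v + size t by rewrite ws_def !size_cat addnA.
have szb : size wb = (size ws).+4 by rewrite szs wb_def !size_cat /=; lia.
have wb_def' : wb = (u ++ [:: a1; a2] ++ v) ++ [:: b1; b2] ++ t.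
  by rewrite wb_def -!catA.
have szm : size (u ++ [:: a1; a2] ++ v) = m by rewrite !size_cat /=; lia.
have sk i : nth dpass wb (skip2 m (skip2 n i)) = nth dpass ws i.
  by rewrite wb_def' ws_def -szm nth_skip2 -!catA nth_skip2.
have n1 : nth dpass wb n = a1 by rewrite wb_def nth_cat ltnn subnn.
have n2 : nth dpass wb n.+1 = a2.
  by rewrite wb_def nth_cat ltnNge leqnSn /= subSnn.
have m1 : nth dpass wb m = b1 by rewrite wb_def' nth_cat szm ltnn subnn.
have m2 : nth dpass wb m.+1 = b2.
  by rewrite wb_def' nth_cat szm ltnNge leqnSn /= subSnn.
have ltn : n.+1 < size wb by lia.
have ltm : m.+1 < size wb by lia.
have nm : n.+1 < m by lia.
have [s [P1 P2]] : exists s : bool, partner wb n = m + s /\ partner wb n.+1 = m + ~~ s.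
  have : lab a1 \in [:: lab b1; lab b2] by rewrite (perm_mem lb) inE eqxx.
  have : lab a2 \in [:: lab b1; lab b2] by rewrite (perm_mem lb) !inE eqxx orbT.
  rewrite !inE => /orP[] /eqP e2 /orP[] /eqP e1.
  - by rewrite e1 e2 eqxx in la.
  - exists true; split; apply: partner_unique => //; rewrite ?addn0 ?addn1 ?n1 ?n2 ?m1 ?m2 //; lia.
  - exists false; split; apply: partner_unique => //; rewrite ?addn0 ?addn1 ?n1 ?n2 ?m1 ?m2 //; lia.
  - by rewrite e1 e2 eqxx in la.
have Q1 := partner_sym bv (ltnW ltn) P1.
have Q2 := partner_sym bv ltn P2.
have R1 := r2l_partner bv (ltnW ltn); rewrite P1 in R1.
have R2 := r2l_partner bv ltn; rewrite P2 in R2.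
have E : r2l wb n.+1 = ~~ r2l wb n.
  apply: bigon_r2l P1 P2 _ => //.
  by have -> : m.+1 = n + size v + 3 by lia.
(* Semiarcs on either side of an inserted pair are pieces of one semiarc of [ws]. A strand reads
   either the bigon side twice or these two outer pieces. *)
have fn : f' n = f' n.+2 by rewrite fL // fM //; lia.
have fm : f' m = f' m.+2 by rewrite /m fR // fM //; lia.
(* The later pair is cancelled first, so that positions [n] and [n.+1] of the earlier pair are not
   shifted. *)
rewrite !BLW_prod szb (@prod_skip2 _ _ m); first last.
- rewrite !pass_permE //; last by lia.
  move: Q1 Q2 R1 R2; rewrite E; case: s {P1 P2};
    rewrite /= ?addn0 ?addn1 => -> -> -> ->;
    [rewrite negbK|]; apply: crossing_perm_cancel;
    case: (r2l wb n); rewrite /= ?addn0 ?addn1 //.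
- by lia.
rewrite (@prod_skip2 _ _ n); first last.
- have -> : skip2 m n = n by rewrite /skip2; case: ifP => //; lia.
  have -> : skip2 m n.+1 = n.+1 by rewrite /skip2; case: ifP => //; lia.
  rewrite !pass_permE //; last by lia.
  rewrite P1 P2 E; apply: crossing_perm_cancel.
  by case: s {P1 P2 Q1 Q2 R1 R2}; case: (r2l _ _) => /=; rewrite ?addn0 ?addn1.
- by lia.
apply: eq_big_nat => i /andP[_ lti].
apply: (pass_perm_transfer sv bv (rho := skip2 m \o skip2 n)) => //=.
- exact: inj_comp (@skip2_inj _) (@skip2_inj _).
- by move=> k ltk; rewrite szb /skip2; do ?case: ifP; lia.
- rewrite /skip2; case: (ltnP _ n) => le; case: ltnP => le2; try lia.
  + by rewrite fL // ltnW.
  + by rewrite fM //; lia.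
  + by rewrite fR //; lia.
- rewrite /skip2; case: (ltnP _ n) => le; case: ltnP => le2; try lia.
  + by rewrite fL.
  + by rewrite fM //; lia.
  + by rewrite fR //; lia.
Qed.
End Moves.

(** * Combinatorics of the R3 triangle *)

Definition swap2 (n i : nat) : nat :=
  if i == n then n.+1 else if i == n.+1 then n else i.

Lemma swap2_inj n : injective (swap2 n).
Proof. by move=> i j; rewrite /swap2; do !case: eqP; lia. Qed.

Lemma swap2_pair n (b : bool) : swap2 n (n + b) = n + ~~ b.
Proof. by rewrite /swap2; case: b; do !case: eqP; lia. Qed.

Lemma swap2_id n i : i != n -> i != n.+1 -> swap2 n i = i.
Proof. by rewrite /swap2 => /negbTE -> /negbTE ->. Qed.

Lemma nth_swap2 (u t : seq pass) a b i :
  nth dpass (u ++ [:: b; a] ++ t) (swap2 (size u) i) =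
  nth dpass (u ++ [:: a; b] ++ t) i.
Proof.
rewrite [LHS]nth_cat [RHS]nth_cat; case: (ltnP i (size u)) => [lt|le].
  by rewrite swap2_id ?lt //; lia.
have [k ->] : exists k, i = size u + k by exists (i - size u); lia.
case: k => [|[|k]].
- by rewrite (swap2_pair _ false) /= addn0 addn1 subnn ltnNge leqnSn subSnn.
- by rewrite (swap2_pair _ true) /= addn0 addn1 ltnn subnn subSnn.
rewrite swap2_id; [|lia..].
by rewrite ltnNge leq_addr /= addKn.
Qed.

(* [p], [q], [r] are the positions, on each strand, of the crossing with the
   next strand in the cyclic order X, Y, Z. *)
Lemma triangle_labels (X Y Z : bool -> nat) a b c :
  X false != X true -> Y false != Y true -> Z false != Z true ->
  uniq [:: a; b; c] ->
  perm_eq [:: X false; X true; Y false; Y true; Z false; Z true]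
          [:: a; a; b; b; c; c] ->
  exists p q r, [/\ X p = Y (~~ q), Y q = Z (~~ r) & Z r = X (~~ p)].
Proof.
move=> hx hy hz; rewrite /= !inE andbT negb_or => /andP[/andP[ab ac] bc] pe.
(* Each of the six labels occurs twice in total and once on its own strand, hence exactly once on
   the other two strands together. *)
pose cnt (U : bool -> nat) l := (U false == l) + (U true == l).
have c2 l : l \in [:: X false; X true; Y false; Y true; Z false; Z true] ->
    cnt X l + cnt Y l + cnt Z l = 2.
  rewrite (perm_mem pe) => lin.
  have /seq.permP/(_ (pred1 l)) /= := pe; rewrite /cnt !addn0 !addnA => ->.
  by move: lin; rewrite !inE; lia.
have cnt1 (U : bool -> nat) s : U false != U true -> cnt U (U s) = 1.
  by rewrite /cnt; case: s => /negbTE h; rewrite eqxx ?h // eq_sym h.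
have cX s : cnt Y (X s) + cnt Z (X s) = 1.
  have := c2 (X s); rewrite (cnt1 _ _ hx) -addnA => h; apply: succn_inj.
  by apply: h; case: s; rewrite !inE eqxx ?orbT.
have cY s : cnt X (Y s) + cnt Z (Y s) = 1.
  have := c2 (Y s); rewrite (cnt1 _ _ hy) addn1 addSn => h; apply: succn_inj.
  by apply: h; case: s; rewrite !inE eqxx ?orbT.
have cZ s : cnt X (Z s) + cnt Y (Z s) = 1.
  have := c2 (Z s); rewrite (cnt1 _ _ hz) addn1 => h; apply: succn_inj.
  by apply: h; case: s; rewrite !inE eqxx ?orbT.
have pick (U V W : bool -> nat) s : cnt V (U s) + cnt W (U s) = 1 ->
    exists t, U s = V t \/ U s = W t.
  rewrite /cnt; case: (V false =P _) => [<-|_]; first by exists false; left.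
  case: (V true =P _) => [<-|_]; first by exists true; left.
  case: (W false =P _) => [<-|_]; first by exists false; right.
  by case: (W true =P _) => [<-|_] //; exists true; right.
have excl s t t' : X s = Y t -> X s = Z t' -> False.
  by move=> h h'; have := cX s; rewrite {1}h h' !cnt1.
move/eqP in hx; move/eqP in hy; move/eqP in hz.
(* If both labels of [X] lay on the same other strand, the third strand could not be matched. So one
   lies on [Y] and the other on [Z], and their order gives [p]. *)
have [t [h|h]] := pick _ _ _ _ (cX false);
  have [t' [h'|h']] := pick _ _ _ _ (cX true).
- have [u [e|e]] := pick _ _ _ _ (cZ false).
    by case: u e => e; [case: (excl true t' false)|case: (excl false t false)].
  exfalso; case: t h => h; case: t' h' => h'; case: u e => e; try congruence;
  first [by apply: (excl false _ false h); congruence | by apply: (excl true _ false h'); congruence].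
- exists false, (~~ t), t'; rewrite negbK; split => //.
  have [u [e|e]] := pick _ _ _ _ (cY (~~ t)).
    exfalso; case: u e => e; last by case: t h e => /= h e; congruence.
    exact: excl (esym e) h'.
  have [<-//|ut] := eqVneq u (~~ t'); exfalso.
  have ut' : u = t' by move: ut; case: (u); case: (t').
  by apply: (excl true (~~ t) t'); congruence.
- exists true, (~~ t'), t; rewrite negbK; split => //.
  have [u [e|e]] := pick _ _ _ _ (cY (~~ t')).
    exfalso; case: u e => e; first by case: t' h' e => /= h' e; congruence.
    exact: excl (esym e) h.
  have [<-//|ut] := eqVneq u (~~ t); exfalso.
  have ut' : u = t by move: ut; case: (u); case: (t).
  by apply: (excl false (~~ t') t); congruence.
- have [u [e|e]] := pick _ _ _ _ (cY false).
    by case: u e => e; [case: (excl true false t')|case: (excl false false t)].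
  exfalso; case: t h => h; case: t' h' => h'; case: u e => e; try congruence;
  first [by apply: (excl false false _ _ h); congruence | by apply: (excl true false _ _ h'); congruence].
Qed.

(** A turn at the other end of semiarc [a.+1] would lead to a semiarc of index [c], [c.+1] or
    [c.+2], which the spacing of [b] and [c] excludes. The turn is thus made at the crossing with
    [b], and [phi_segment] applies. *)
Lemma face_step w a b c (s t t' d d' : bool) : gauss_valid w ->
  a.+1 < size w -> c.+1 < b \/ b.+1 < c ->
  partner w (a + s) = b + t -> partner w (a + ~~ s) = c + t' ->
  phi w (a.+1, d) = (b.+1, d') ->
  [/\ ~~ d = s, d' = t & (r2l w (a + s) == s) = ~~ t].
Proof.
move=> wv lt bc Pb Pc ph.
have la : a + ~~ d < size w by case: (d); lia.
have ds : ~~ d = s.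
  apply/eqP; apply: contraT => ds; exfalso.
  have {}Pc : partner w (a + ~~ d) = c + t'.
    by rewrite -Pc; congr (partner w (a + _)); move: ds; case: (d); case: (s).
  move: ph; rewrite phiE // Pc.
  by case: ifP => _ []; case: (t'); lia.
rewrite -ds in Pb *; have [-> ->] := phi_segment wv la Pb ph.
by split.
Qed.

(** The triangle is traversed either in the order X, Y, Z or in the order X, Z, Y. Each corner
    expresses one exponent through two of the booleans; the direction fixes [k] as
    [~~ (p (+) q (+) r)] or as [p (+) q (+) r] respectively. *)
Lemma triangle_r2l w x y z (p q r : bool) : gauss_valid w ->
  x.+1 < y -> y.+1 < z -> z.+1 < size w ->
  partner w (x + p) = y + ~~ q -> partner w (y + q) = z + ~~ r ->
  partner w (z + r) = x + ~~ p -> triangle_face w x.+1 y.+1 z.+1 ->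
  exists k : bool, [/\ r2l w (x + p) = r (+) k, r2l w (y + q) = p (+) k &
                       r2l w (z + r) = q (+) k].
Proof.
move=> wv xy yz zw Pxy Pyz Pzx.
have [xw yw xz] : [/\ x.+1 < size w, y.+1 < size w & x.+1 < z] by split; lia.
have lx : x + p < size w by case: (p); lia.
have ly : y + q < size w by case: (q); lia.
have lz : z + r < size w by case: (r); lia.
have Pyx := partner_sym wv lx Pxy.
have Pzy := partner_sym wv ly Pyz.
have Pxz := partner_sym wv lz Pzx.
have := r2l_partner wv lx; rewrite Pxy.
have := r2l_partner wv ly; rewrite Pyz.
have := r2l_partner wv lz; rewrite Pzx => Rxz Rzy Ryx.
have nn (a : nat) (b : bool) : a + ~~ ~~ b = a + b by rewrite negbK.
move=> [[_ d1] [[b2 d2] [[b3 d3] [/= -> [[-> ->]|[-> ->]] ph1 ph2 ph3]]]].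
  have [_ _ E1] := face_step wv xw (or_intror yz) Pxy Pxz ph1.
  have [_ _ E2] := face_step wv yw (or_introl xz) Pyz Pyx ph2.
  have [_ _ E3] := face_step wv zw (or_intror xy) Pzx Pzy ph3.
  exists (~~ (p (+) q (+) r)).
  move: E1 E2 E3; move: (r2l w (x + p)) (r2l w (y + q)) (r2l w (z + r)).
by case: (p); case: (q); case: (r) => [] [] [] [].
rewrite -(nn x) in Pxy; rewrite -(nn y) in Pyz; rewrite -(nn z) in Pzx.
have [_ _ E1] := face_step wv xw (or_introl yz) Pxz Pxy ph1.
have [_ _ E2] := face_step wv zw (or_introl xy) Pzy Pzx ph2.
have [_ _ E3] := face_step wv yw (or_intror xz) Pyx Pyz ph3.
exists (p (+) q (+) r).
rewrite Rxz Rzy Ryx in E1 E2 E3.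
move: E1 E2 E3; move: (r2l w (x + p)) (r2l w (y + q)) (r2l w (z + r)).
by case: (p); case: (q); case: (r) => [] [] [] [].
Qed.

(** * The algebraic identity for one strand of R3 *)

Section Strand.
Variables (X : finType) (be : X -> {perm X}).
Local Open Scope group_scope.

(* The [be]'s compose to the identity around the crossing of passes [i] and [j],
   where [e] is the exponent of pass [i]. *)
Definition flat (f : nat -> X) (i j : nat) (e : bool) : Prop :=
  if e then be (f i) * be (f j) = be (f j.+1) * be (f i.+1)
  else be (f j) * be (f i) = be (f i.+1) * be (f j.+1).

(** The commutative square [a * b = c * d] read between other pairs of opposite corners. *)
Lemma mulg_rotations (gT : finGroupType) (a b c d : gT) : a * b = c * d ->
  [/\ c^-1 * a = d * b^-1, b^-1 * a^-1 = d^-1 * c^-1 & b * d^-1 = a^-1 * c].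
Proof.
move=> h; split.
- by apply: (mulgI c); rewrite mulKVg mulgA -h mulgK.
- by rewrite -!invMg h.
- by apply: (mulgI a); rewrite mulKVg mulgA h mulgK.
Qed.

(** When [q (+) r (+) k] is false, the strand reads the two triangle sides before the move and outer
    colors after it. The outer colors are common to [f] and [f'], so the identity is a rotation of
    the relation for [f]. Otherwise it reads outer colors before and triangle sides after, and the
    relation for [f'] is used. The boolean [p] only tells which of the two strands is met first. *)
Lemma triangle_strand (f f' : nat -> X) y z (p q r k : bool) :
  f' y = f y -> f' y.+2 = f y.+2 -> f' z = f z -> f' z.+2 = f z.+2 ->
  flat f (y + q) (z + ~~ r) (p (+) k) -> flat f' (y + ~~ q) (z + r) (p (+) k) ->
  let Y := crossing_perm be f (y + ~~ q) (r (+) k) in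
  let Z := crossing_perm be f (z + r) (~~ (q (+) k)) in
  let Y' := crossing_perm be f' (y + q) (r (+) k) in
  let Z' := crossing_perm be f' (z + ~~ r) (~~ (q (+) k)) in
  if p then Z * Y = Y' * Z' else Y * Z = Z' * Y'.
Proof.
move=> y0 y2 z0 z2; rewrite /flat /crossing_perm.
case: p; case: q; case: r; case: k; rewrite /= ?addn0 ?addn1 ?y0 ?y2 ?z0 ?z2;
  move=> h h'; try (by []);
  have [h1 h2 h3] := mulg_rotations h; have [h1' h2' h3'] := mulg_rotations h'; try (by []).
Qed.
End Strand.

(* The face condition leaves one degree of freedom [k] for the three exponents;
   the R3 move negates all four booleans. *)
Definition triangle (w : seq pass) (x y z : nat) (p q r k : bool) : Prop :=
  [/\ partner w (x + p) = y + ~~ q, partner w (y + q) = z + ~~ r &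
      partner w (z + r) = x + ~~ p] /\
  [/\ r2l w (x + p) = r (+) k, r2l w (y + q) = p (+) k & r2l w (z + r) = q (+) k].

(** This cyclic symmetry lets an argument for strand X serve for all three strands. *)
Lemma triangle_rot w x y z p q r k :
  triangle w x y z p q r k -> triangle w y z x q r p k.
Proof. by move=> [[? ? ?] [? ? ?]]. Qed.

Lemma ltn_addb n (s : bool) N : n.+1 < N -> n + s < N.
Proof. by case: s; lia. Qed.

Lemma neq_addb m n (s t : bool) : m.+1 < n -> (n + t != m + s) && (m + s != n + t).
Proof. by case: s; case: t; lia. Qed.

(** * The permutation of positions effected by R3 *)

Section ThreePairs.
Variables x y z : nat.

Definition swap3 : nat -> nat := swap2 x \o swap2 y \o swap2 z.

Definition in3 (i : nat) : bool :=
  [|| i == x, i == x.+1, i == y, i == y.+1, i == z | i == z.+1].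

Lemma swap3_inj : injective swap3.
Proof. by apply: inj_comp; [apply: inj_comp|]; exact: swap2_inj. Qed.

Lemma swap3_id i : ~~ in3 i -> swap3 i = i.
Proof.
by rewrite /in3 !negb_or => /and5P[? ? ? ? /andP[? ?]]; rewrite /swap3 /= !swap2_id.
Qed.

Lemma in3P i : reflect (exists s : bool, [\/ i = x + s, i = y + s | i = z + s]) (in3 i).
Proof.
apply: (iffP idP) => [|[s [] ->]]; rewrite /in3; last first.
- by case: s; rewrite ?addn0 ?addn1 eqxx ?orbT.
- by case: s; rewrite ?addn0 ?addn1 eqxx ?orbT.
- by case: s; rewrite ?addn0 ?addn1 eqxx ?orbT.
case/orP=> [/eqP->|/orP[/eqP->|/orP[/eqP->|/orP[/eqP->|/orP[/eqP->|/eqP->]]]]].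
- by exists false; constructor 1; rewrite addn0.
- by exists true; constructor 1; rewrite addn1.
- by exists false; constructor 2; rewrite addn0.
- by exists true; constructor 2; rewrite addn1.
- by exists false; constructor 3; rewrite addn0.
- by exists true; constructor 3; rewrite addn1.
Qed.

(** The sides of the triangle are the only semiarcs whose color may change; none of them is adjacent
    to a pass outside the triangle. *)
Lemma in3_ends i : ~~ in3 i ->
  i \notin [:: x.+1; y.+1; z.+1] /\ i.+1 \notin [:: x.+1; y.+1; z.+1].
Proof. by rewrite /in3 !inE !eqSS; lia. Qed.

Hypotheses (xy : x.+1 < y) (yz : y.+1 < z).

Lemma swap3_x (s : bool) : swap3 (x + s) = x + ~~ s.
Proof.
rewrite /swap3 /= (swap2_id (n := z)) ?(swap2_id (n := y)) ?swap2_pair //;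
by case: s; lia.
Qed.

Lemma swap3_y (s : bool) : swap3 (y + s) = y + ~~ s.
Proof.
rewrite /swap3 /= (swap2_id (n := z)) ?swap2_pair ?(swap2_id (n := x)) //;
by case: s; lia.
Qed.

Lemma swap3_z (s : bool) : swap3 (z + s) = z + ~~ s.
Proof.
rewrite /swap3 /= swap2_pair (swap2_id (n := y)) ?(swap2_id (n := x)) //;
by case: s; lia.
Qed.

Lemma swap3_lt N i : z.+1 < N -> i < N -> swap3 i < N.
Proof.
move=> zN iN; have [/in3P[s [] ->]|/swap3_id -> //] := boolP (in3 i).
- by rewrite swap3_x ltn_addb //; lia.
- by rewrite swap3_y ltn_addb //; lia.
- by rewrite swap3_z ltn_addb //; lia.
Qed.

Lemma ends3 n : n \in [:: x; y; z] ->
  n \notin [:: x.+1; y.+1; z.+1] /\ n.+2 \notin [:: x.+1; y.+1; z.+1].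
Proof. by rewrite !inE !eqSS; lia. Qed.

Lemma in3_gaps i :
  [/\ i < x -> ~~ in3 i, x.+2 <= i < y -> ~~ in3 i,
      y.+2 <= i < z -> ~~ in3 i & z.+2 <= i -> ~~ in3 i].
Proof. by split; rewrite /in3; lia. Qed.
End ThreePairs.

(** * Invariance under R3 *)

Section R3.
Variables (X : finType) (al be : X -> {perm X}).
Hypothesis bq : biquandle al be.

Lemma coloring_flat w f i j : gauss_valid w -> coloring al be w f -> i < size w ->
  partner w i = j -> flat be f i j (r2l w i).
Proof.
move=> wv fc ltiw <-; have [ltjw _ _ _ _] := partnerP wv ltiw.
rewrite /flat; case: ifP => ri; first exact: (crossing_flat bq wv fc ltiw).
by apply: (crossing_flat bq wv fc ltjw (partnerK wv ltiw)); rewrite r2l_partner ?ri.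
Qed.

(** Strand X meets Y at [x + p] before the move and at [x + ~~ p] after it, with unchanged
    exponents. The crossing of Y and Z supplies the relations that [triangle_strand] needs in both
    diagrams. *)
Lemma strand_pair w w' f f' x y z p q r k :
  gauss_valid w -> gauss_valid w' -> coloring al be w f -> coloring al be w' f' ->
  triangle w x y z p q r k -> triangle w' x y z (~~ p) (~~ q) (~~ r) (~~ k) ->
  x.+1 < size w -> y.+1 < size w -> z.+1 < size w -> size w' = size w ->
  f' y = f y -> f' y.+2 = f y.+2 -> f' z = f z -> f' z.+2 = f z.+2 ->
  (pass_perm be w f x * pass_perm be w f x.+1 =
   pass_perm be w' f' x * pass_perm be w' f' x.+1)%g.
Proof.
move=> wv wv' fc fc' [[Pxy Pyz Pzx] [Rx Ry Rz]] [[Pxy' Pyz' Pzx'] [Rx' Ry' Rz']].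
move=> xw yw zw szw' y0 y2 z0 z2; rewrite !negbK in Pxy' Pyz' Pzx'.
have lt n (b : bool) := @ltn_addb n b (size w).
have lxy := lt x p xw; have lyz := lt y q yw; have lzx := lt z r zw.
have lxy' := lt x (~~ p) xw; have lyz' := lt y (~~ q) yw; have lzx' := lt z (~~ r) zw.
have F := coloring_flat wv fc lyz Pyz; rewrite Ry in F.
have F' := coloring_flat wv' fc' (i := y + ~~ q); rewrite szw' in F'.
have {}F' := F' _ lyz' Pyz'; rewrite Ry' addNb addbN negbK in F'.
have := triangle_strand y0 y2 z0 z2 F F'.
have Pxz := partner_sym wv lzx Pzx.
have := r2l_partner wv lzx; rewrite Pzx Rz => Rxz.
rewrite -szw' in lzx' lxy'.
have Pxz' := partner_sym wv' lzx' Pzx'.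
have := r2l_partner wv' lzx'; rewrite Pzx' Rz' => Rxz'.
rewrite !addNb !addbN !negbK in Rx' Rxz'.
rewrite !pass_permE ?szw' ?(ltnW xw) //.
case: p Pxy Pzx Rx Pxy' Pzx' Rx' Pxz Rxz Pxz' Rxz' {F F' Ry Ry' lxy lxy'};
  rewrite /= ?addn0 ?addn1 => -> _ -> -> _ -> -> -> -> -> //.
Qed.

Lemma BLW_R3 w w' cor f f' : gauss_valid w -> gauss_valid w' ->
  coloring al be w f -> coloring al be w' f' ->
  R3 w w' cor -> (forall k k', cor k k' -> f' k' = f k) ->
  BLW be w' f' = BLW be w f.
Proof.
move=> wv wv' fc fc' [u1 [u2 [u3 [u4 [x1 [x2 [y1 [y2 [z1 [z2 [a [b [c]]]]]]]]]]]]]; cbv zeta.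
move=> [[w_def w'_def] /and5P[lx ly lz uabc labs] _ face corE] ff'.
pose x := size u1; pose y := size u1 + size u2 + 2.
pose z := size u1 + size u2 + size u3 + 4.
have xy : x.+1 < y by lia.
have yz : y.+1 < z by lia.
have szw : size w = z.+2 + size u4 by rewrite w_def !size_cat /=; lia.
have szw' : size w' = size w by rewrite w_def w'_def !size_cat.
have zw : z.+1 < size w by lia.
have fout k : k \notin [:: x.+1; y.+1; z.+1] -> f' k = f k.
  move=> kout; apply: ff'; rewrite corE eqxx.
  by move: kout; rewrite /x /y /z !inE !negb_or; lia.
have {}face : triangle_face w x.+1 y.+1 z.+1.
  have -> : y.+1 = size u1 + size u2 + 3 by lia.
  by have -> : z.+1 = size u1 + size u2 + size u3 + 5 by lia.
pose rho := swap3 x y z.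
pose s2 := u1 ++ [:: x1; x2] ++ u2; pose s3 := s2 ++ [:: y1; y2] ++ u3.
have sz2 : size s2 = y by rewrite !size_cat /=; lia.
have sz3 : size s3 = z by rewrite !size_cat /=; lia.
have w_def2 : w = s2 ++ [:: y1; y2] ++ u3 ++ [:: z1; z2] ++ u4.
  by rewrite w_def /s2 -!catA.
have w_def3 : w = s3 ++ [:: z1; z2] ++ u4 by rewrite w_def2 /s3 -!catA.
have rho_nth i : nth dpass w' (rho i) = nth dpass w i.
  (* The three swaps are undone one at a time; [e2] and [e3] regroup the word so that the next
     swapped pair directly follows a single prefix. *)
  have e2 : u1 ++ [:: x1; x2] ++ u2 ++ [:: y2; y1] ++ u3 ++ [:: z2; z1] ++ u4 =
            s2 ++ [:: y2; y1] ++ u3 ++ [:: z2; z1] ++ u4 by rewrite /s2 -!catA.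
  have e3 : s2 ++ [:: y1; y2] ++ u3 ++ [:: z2; z1] ++ u4 =
            s3 ++ [:: z2; z1] ++ u4 by rewrite /s3 -!catA.
  rewrite /rho /swap3 /= w'_def nth_swap2 e2 -sz2 nth_swap2 e3 -sz3 nth_swap2.
  by rewrite w_def3.
have nx1 : nth dpass w x = x1 by rewrite w_def nth_cat ltnn subnn.
have nx2 : nth dpass w x.+1 = x2 by rewrite w_def nth_cat ltnNge leqnSn /= subSnn.
have ny1 : nth dpass w y = y1 by rewrite w_def2 nth_cat sz2 ltnn subnn.
have ny2 : nth dpass w y.+1 = y2.
  by rewrite w_def2 nth_cat sz2 ltnNge leqnSn /= subSnn.
have nz1 : nth dpass w z = z1 by rewrite w_def3 nth_cat sz3 ltnn subnn.
have nz2 : nth dpass w z.+1 = z2.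
  by rewrite w_def3 nth_cat sz3 ltnNge leqnSn /= subSnn.
pose L n (s : bool) := lab (nth dpass w (n + s)).
have [p [q [r [Lxy Lyz Lzx]]]] : exists p q r,
    [/\ L x p = L y (~~ q), L y q = L z (~~ r) & L z r = L x (~~ p)].
  by apply: (triangle_labels (a := a) (b := b) (c := c)) => //;
    rewrite /L !addn0 !addn1 ?nx1 ?nx2 ?ny1 ?ny2 ?nz1 ?nz2.
have lt n (b : bool) := @ltn_addb n b (size w).
have xw : x.+1 < size w by lia.
have yw : y.+1 < size w by lia.
have xz : x.+1 < z by lia.
have Pxy : partner w (x + p) = y + ~~ q.
  by apply: partner_unique; rewrite ?lt // ; case/andP: (neq_addb p (~~ q) xy).
have Pyz : partner w (y + q) = z + ~~ r.
  by apply: partner_unique; rewrite ?lt // ; case/andP: (neq_addb q (~~ r) yz).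
have Pzx : partner w (z + r) = x + ~~ p.
  by apply: partner_unique; rewrite ?lt //; case/andP: (neq_addb (~~ p) r xz).
have [k [Rx Ry Rz]] := triangle_r2l wv xy yz zw Pxy Pyz Pzx face.
have tri : triangle w x y z p q r k by [].
have [[rhox rhoy] rhoz] := (swap3_x xy yz, swap3_y xy yz, swap3_z xy yz).
rewrite -/rho in rhox rhoy rhoz.
have rhoI : injective rho by exact: swap3_inj.
have rho_lt i : i < size w -> rho i < size w'.
  by rewrite szw'; apply: swap3_lt.
(* Positions within each pair are exchanged, which negates [p], [q], [r]. Exponents are kept, so [k]
   must be negated as well. *)
have tri' : triangle w' x y z (~~ p) (~~ q) (~~ r) (~~ k).
  have PT i (li : i < size w) := partner_transfer wv wv' rhoI rho_lt rho_nth li.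
  have RT i := r2l_transfer rho_nth i.
  split; split.
  - by rewrite -rhox PT ?lt // Pxy rhoy.
  - by rewrite -rhoy PT ?lt // Pyz rhoz.
  - by rewrite -rhoz PT ?lt // Pzx rhox.
  - by rewrite -rhox RT Rx addNb addbN negbK.
  - by rewrite -rhoy RT Ry addNb addbN negbK.
  - by rewrite -rhoz RT Rz addNb addbN negbK.
have ends n : n \in [:: x; y; z] -> f' n = f n /\ f' n.+2 = f n.+2.
  by case/(ends3 xy yz) => ? ?; split; apply: fout.
have [[fx0 fx2] [fy0 fy2] [fz0 fz2]] :
    [/\ f' x = f x /\ f' x.+2 = f x.+2, f' y = f y /\ f' y.+2 = f y.+2 &
        f' z = f z /\ f' z.+2 = f z.+2].
  by split; apply: ends; rewrite !inE eqxx ?orbT.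
have Ex := strand_pair wv wv' fc fc' tri tri' xw yw zw szw' fy0 fy2 fz0 fz2.
have tri2 := triangle_rot tri; have tri2' := triangle_rot tri'.
have Ey := strand_pair wv wv' fc fc' tri2 tri2' yw zw xw szw' fz0 fz2 fx0 fx2.
have tri3 := triangle_rot tri2; have tri3' := triangle_rot tri2'.
have Ez := strand_pair wv wv' fc fc' tri3 tri3' zw xw yw szw' fx0 fx2 fy0 fy2.
have insX (s : bool) : in3 x y z (x + s) by apply/in3P; exists s; constructor 1.
have insY (s : bool) : in3 x y z (y + s) by apply/in3P; exists s; constructor 2.
have insZ (s : bool) : in3 x y z (z + s) by apply/in3P; exists s; constructor 3.
have bcase (s t : bool) : s = t \/ s = ~~ t by case: s; case: t; auto.
(* The six passes of the triangle are closed under [partner], so a pass outside it crosses a strand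
   at another outside pass, whose adjacent colors are unchanged. *)
have ins_partner i : in3 x y z i -> in3 x y z (partner w i).
  case/in3P=> s [] ->.
  - have [->|->] := bcase s p; first by rewrite Pxy.
    by rewrite (partner_sym wv (lt z r zw) Pzx).
  - have [->|->] := bcase s q; first by rewrite Pyz.
    by rewrite (partner_sym wv (lt x p xw) Pxy).
  - have [->|->] := bcase s r; first by rewrite Pzx.
    by rewrite (partner_sym wv (lt y q yw) Pyz).
have out i : i < size w -> ~~ in3 x y z i -> pass_perm be w' f' i = pass_perm be w f i.
  move=> ltiw iout.
  have jout : ~~ in3 x y z (partner w i).
    by apply: contra iout => /ins_partner; rewrite partnerK.
  rewrite -{1}(swap3_id iout) -/rho.
  have [j0 j1] := in3_ends jout; have rj : rho (partner w i) = partner w i := swap3_id jout.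
  by apply: (pass_perm_transfer wv wv' rhoI rho_lt rho_nth); rewrite ?rj ?fout.
have outP m n : n <= size w -> (forall i, m <= i < n -> ~~ in3 x y z i) ->
    (\prod_(m <= i < n) pass_perm be w' f' i = \prod_(m <= i < n) pass_perm be w f i)%g.
  move=> le h; apply: eq_big_nat => i hi; apply: out; last exact: h.
  by case/andP: hi => _ /leq_trans; apply.
rewrite !BLW_prod szw'.
(* Each weight is cut into the three pairs, equal by [Ex], [Ey], [Ez], and the four intervals
   between and around them, equal factor by factor. *)
have split3 (F : nat -> {perm X}) := prod_pair F (leq0n x) xw.
rewrite !split3 !(prod_pair _ xy yw) !(prod_pair _ yz zw) -Ex -Ey -Ez.
rewrite (outP 0 x) ?(outP x.+2 y) ?(outP y.+2 z) ?(outP z.+2 (size w)) //;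
  rewrite ?(ltnW (ltnW xw)) ?(ltnW (ltnW yw)) ?(ltnW (ltnW zw)) //;
  move=> i; have [g1 g2 g3 g4] := in3_gaps xy yz i => //.
by case/andP=> /g4.
Qed.
End R3.

Theorem mainTheorem3 (X : finType) (al be : X -> {perm X}) (w w' : seq pass)
    (cor : nat -> nat -> bool) (f f' : nat -> X) :
  biquandle al be ->
  knotoid_diagram w -> knotoid_diagram w' ->
  reidemeister_move w w' cor ->
  coloring al be w f -> coloring al be w' f' ->
  (forall k k', cor k k' -> f' k' = f k) ->
  BLW be w' f' = BLW be w f.
Proof.
move=> bq /andP[wv _] /andP[wv' _] mv fc fc' ff'.
(* This reversed agreement serves the inverse R1 and R2 moves, where [w'] is the diagram with fewer
   crossings. *)
have ff k k' : cor k' k -> f k' = f' k by move=> /ff' ->.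
case: mv => [|[|[|[]]]] mv.
- exact: BLW_R1ins mv ff'.
- by symmetry; apply: BLW_R1ins mv ff.
- exact: BLW_R2ins mv ff'.
- by symmetry; apply: BLW_R2ins mv ff.
- exact: (BLW_R3 bq wv wv' fc fc' mv ff').
Qed.
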